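(* Let $\mathbf{F}$ be an arbitrary field and let $(T,[\cdot,\cdot,\cdot],\alpha)$ be a multiplicative Hom-Lie triple system over $\mathbf{F}$. Let $d_t(x,y,z)=\sum_{i\ge0}d_i(x,y,z)t^i$ and $d_t'(x,y,z)=\sum_{i\ge0}d_i'(x,y,z)t^i$ be equivalent 1-parameter formal deformations of $(T,[\cdot,\cdot,\cdot],\alpha)$. Then $d_1$ and $d_1'$ belong to the same cohomology class in $H^3_{\alpha,\alpha}(T,T)$.
   Context: **Multiplicative Hom-Lie triple system (Hom-LTS).** A triple $(T,[\cdot,\cdot,\cdot],\alpha)$ with $T$ an $\mathbf{F}$-vector space, a trilinear map $T\times T\times T\to T$, $(x,y,z)\mapsto[xyz]$, and a linear map $\alpha:T\to T$ such that for all $x,y,z,u,v\in T$: (1) $[xxz]=0$; (2) $[xyz]+[yzx]+[zxy]=0$; (3) $[\alpha(u)\alpha(v)[xyz]]=[[uvx]\alpha(y)\alpha(z)]+[\alpha(x)[uvy]\alpha(z)]+[\alpha(x)\alpha(y)[uvz]]$; (4) $\alpha([xyz])=[\alpha(x)\alpha(y)\alpha(z)]$. **Formal deformations.** $T[[t]]$ denotes the $\mathbf{F}[[t]]$-module of formal power series with coefficients in $T$. An $\mathbf{F}$-(multi)linear map on $T$ is extended to $T[[t]]$ $\mathbf{F}[[t]]$-(multi)linearly, e.g. $f(\sum_i x_it^i,\sum_j y_jt^j,\sum_k z_kt^k)=\sum_{i,j,k\ge0}f(x_i,y_j,z_k)t^{i+j+k}$. A 1-parameter formal deformation of $(T,[\cdot,\cdot,\cdot],\alpha)$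 is a formal power series $d_t=\sum_{i\ge0}d_it^i:T[[t]]^3\to T[[t]]$, where each $d_i:T^3\to T$ is $\mathbf{F}$-trilinear (extended to $T[[t]]$) and $d_0(x,y,z)=[xyz]$, such that - $d_t(\alpha(x),\alpha(y),\alpha(z))=\alpha(d_t(x,y,z))$; - $d_t(x,x,y)=0$; - $d_t(x,y,z)+d_t(y,z,x)+d_t(z,x,y)=0$; - $d_t(\alpha(u),\alpha(v),d_t(x,y,z))=d_t(d_t(u,v,x),\alpha(y),\alpha(z))+d_t(\alpha(x),d_t(u,v,y),\alpha(z))+d_t(\alpha(x),\alpha(y),d_t(u,v,z))$. **Equivalence.** Two 1-parameter formal deformations $d_t,d_t'$ are equivalent if there is a formal isomorphism of $\mathbf{F}[[t]]$-modules $\phi_t=\sum_{i\ge0}\phi_it^i:T[[t]]\to T[[t]]$, where each $\phi_i:T\to T$ is $\mathbf{F}$-linear (extended $\mathbf{F}[[t]]$-linearly) and $\phi_0=\mathrm{id}_T$, with $\phi_t\circ\alpha=\alpha\circ\phi_t$ and $\phi_t(d_t(x,y,z))=d_t'(\phi_t(x),\phi_t(y),\phi_t(z))$. **Cohomology with adjoint coefficients, degree 3.** (This is for $V=T$, $A=\alpha$ and the adjoint representation $\theta(x,y)(z)=[zxy]$.) - $C^1_{\alpha,\alpha}(T,T)$ is the space of linear maps $f:T\to T$ with $\alpha\circ f=f\circ\alpha$. - $C^3_{\alpha,\alpha}(T,T)$ is the space of trilinear maps $f:T^3\to T$ with $\alpha(f(x,y,z))=f(\alpha(x),\alpha(y),\alpha(z))$,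 $f(x,x,z)=0$, $f(x,y,z)+f(y,z,x)+f(z,x,y)=0$. - $\delta^1_{hom}f(x_1,x_2,x_3)=[f(x_1)x_2x_3]+[x_1f(x_2)x_3]+[x_1x_2f(x_3)]-f([x_1x_2x_3])$. - $$\begin{aligned}\delta^3_{hom}f(x_1,\dots,x_5)=\;&[f(x_1,x_2,x_3)\alpha(x_4)\alpha(x_5)]+[\alpha(x_3)f(x_1,x_2,x_4)\alpha(x_5)]\\&+[\alpha(x_3)\alpha(x_4)f(x_1,x_2,x_5)]-[\alpha(x_1)\alpha(x_2)f(x_3,x_4,x_5)]\\&+f([x_1x_2x_3],\alpha(x_4),\alpha(x_5))+f(\alpha(x_3),[x_1x_2x_4],\alpha(x_5))\\&+f(\alpha(x_3),\alpha(x_4),[x_1x_2x_5])-f(\alpha(x_1),\alpha(x_2),[x_3x_4x_5]).\end{aligned}$$ - $Z^3_{\alpha,\alpha}(T,T)=\{f\in C^3_{\alpha,\alpha}(T,T)\mid\delta^3_{hom}f=0\}$, $B^3_{\alpha,\alpha}(T,T)=\delta^1_{hom}C^1_{\alpha,\alpha}(T,T)\subseteq Z^3_{\alpha,\alpha}(T,T)$, and $H^3_{\alpha,\alpha}(T,T)=Z^3_{\alpha,\alpha}(T,T)/B^3_{\alpha,\alpha}(T,T)$. *)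

(* Defs.v *)
From HB Require Import structures.
From mathcomp Require Import all_boot all_order all_algebra.
From mathcomp Require Import boolp classical_sets functions.
Set Implicit Arguments.
Unset Strict Implicit.
Unset Printing Implicit Defensive.
Import GRing.Theory.
Local Open Scope classical_set_scope.
Local Open Scope ring_scope.

Section Trilinear.
Variables (F : fieldType) (T : lmodType F).

Record trilinear (f : T -> T -> T -> T) : Prop := Trilinear {
  trilinear1 : forall y z, linear (fun x => f x y z);
  trilinear2 : forall x z, linear (fun y => f x y z);
  trilinear3 : forall x y, linear (fun z => f x y z) }.

End Trilinear.

Record homLTS (F : fieldType) (T : lmodType F) := HomLTS {
  bracket : T -> T -> T -> T;
  twist : {linear T -> T};
  bracket_trilinear : trilinear bracket;
  bracket_alt : forall x z, bracket x x z = 0;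
  bracket_cyclic : forall x y z,
    bracket x y z + bracket y z x + bracket z x y = 0;
  bracket_hom_fundamental : forall u v x y z,
    bracket (twist u) (twist v) (bracket x y z) =
      bracket (bracket u v x) (twist y) (twist z)
      + bracket (twist x) (bracket u v y) (twist z)
      + bracket (twist x) (twist y) (bracket u v z);
  twist_bracket : forall x y z,
    twist (bracket x y z) = bracket (twist x) (twist y) (twist z) }.

(* A series \sum_n x_n t^n in V[[t]] is its sequence of coefficients; addition
   and zero are the pointwise ones already present on nat -> V. *)
Notation tseries V := (nat -> V).

Section Series.
Variables (F : fieldType) (T : lmodType F).

Definition tscale (c : tseries F) (x : tseries T) : tseries T :=
  fun n => \sum_(i < n.+1) c i *: x (n - i)%N.

Definition text1 (f : T -> T) (x : tseries T) : tseries T := fun n => f (x n).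

Definition text3 (f : T -> T -> T -> T) (x y z : tseries T) : tseries T :=
  fun n => \sum_(i < n.+1) \sum_(j < n.+1)
             \sum_(k < n.+1 | (i + j + k == n)%N) f (x i) (y j) (z k).

(* The maps \sum_i phi_i t^i and \sum_i d_i t^i; the factor t^i shifts
   coefficients by i. *)
Definition tmap1 (phi : nat -> T -> T) (x : tseries T) : tseries T :=
  fun n => \sum_(i < n.+1) text1 (phi i) x (n - i)%N.

Definition tmap3 (d : nat -> T -> T -> T -> T) (x y z : tseries T) :
    tseries T :=
  fun n => \sum_(i < n.+1) text3 (d i) x y z (n - i)%N.

Record tmodule_iso (g : tseries T -> tseries T) : Prop := TModuleIso {
  tmodule_isoD : forall x y, g (x + y) = g x + g y;
  tmodule_isoZ : forall c x, g (tscale c x) = tscale c (g x);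
  tmodule_iso_bij : bijective g }.

End Series.

Section Deformation.
Variables (F : fieldType) (T : lmodType F) (H : homLTS T).
Local Notation alpha_t := (text1 (twist H)).

Record formal_deformation (d : nat -> T -> T -> T -> T) : Prop :=
  FormalDeformation {
  deform_trilinear : forall i, trilinear (d i);
  deform0 : d 0%N = bracket H;
  deform_twist : forall x y z : tseries T,
    tmap3 d (alpha_t x) (alpha_t y) (alpha_t z) = alpha_t (tmap3 d x y z);
  deform_alt : forall x y : tseries T, tmap3 d x x y = 0;
  deform_cyclic : forall x y z : tseries T,
    tmap3 d x y z + tmap3 d y z x + tmap3 d z x y = 0;
  deform_hom_fundamental : forall u v x y z : tseries T,
    tmap3 d (alpha_t u) (alpha_t v) (tmap3 d x y z) =
      tmap3 d (tmap3 d u v x) (alpha_t y) (alpha_t z)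
      + tmap3 d (alpha_t x) (tmap3 d u v y) (alpha_t z)
      + tmap3 d (alpha_t x) (alpha_t y) (tmap3 d u v z) }.

(* [formal_iso_module] follows from the two fields before it. *)
Record formal_iso (d d' : nat -> T -> T -> T -> T) (phi : nat -> T -> T) :
    Prop := FormalIso {
  formal_iso_linear : forall i, linear (phi i);
  formal_iso0 : phi 0%N = id;
  formal_iso_module : tmodule_iso (tmap1 phi);
  formal_iso_twist : forall x : tseries T,
    tmap1 phi (alpha_t x) = alpha_t (tmap1 phi x);
  formal_iso_deform : forall x y z : tseries T,
    tmap1 phi (tmap3 d x y z) =
      tmap3 d' (tmap1 phi x) (tmap1 phi y) (tmap1 phi z) }.

Definition deform_equiv (d d' : nat -> T -> T -> T -> T) : Prop :=
  exists phi, formal_iso d d' phi.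

End Deformation.

Section Cohomology.
Variables (F : fieldType) (T : lmodType F) (H : homLTS T).
Local Notation "[ x , y , z ]" := (bracket H x y z)
  (at level 0, x, y, z at level 99).
Local Notation alpha := (twist H).

Definition C1 : set (T -> T) :=
  [set f | linear f /\ forall x, alpha (f x) = f (alpha x)].

Definition C3 : set (T -> T -> T -> T) :=
  [set f | [/\ trilinear f,
    forall x y z, alpha (f x y z) = f (alpha x) (alpha y) (alpha z),
    forall x z, f x x z = 0 &
    forall x y z, f x y z + f y z x + f z x y = 0]].

Definition delta1 (f : T -> T) : T -> T -> T -> T := fun x1 x2 x3 =>
  [f x1, x2, x3] + [x1, f x2, x3] + [x1, x2, f x3] - f [x1, x2, x3].

Definition delta3 (f : T -> T -> T -> T) : T -> T -> T -> T -> T -> T :=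
  fun x1 x2 x3 x4 x5 =>
    [f x1 x2 x3, alpha x4, alpha x5] + [alpha x3, f x1 x2 x4, alpha x5]
    + [alpha x3, alpha x4, f x1 x2 x5] - [alpha x1, alpha x2, f x3 x4 x5]
    + f [x1, x2, x3] (alpha x4) (alpha x5)
    + f (alpha x3) [x1, x2, x4] (alpha x5)
    + f (alpha x3) (alpha x4) [x1, x2, x5]
    - f (alpha x1) (alpha x2) [x3, x4, x5].

Definition Z3 : set (T -> T -> T -> T) := [set f | C3 f /\ delta3 f = 0].

Definition B3 : set (T -> T -> T -> T) := delta1 @` C1.

Definition cohomology_class (f : T -> T -> T -> T) : set (T -> T -> T -> T) :=
  [set g | Z3 g /\ B3 (g - f)].

(* The quotient Z3 / B3, as the set of its cosets. *)
Definition H3 : set (set (T -> T -> T -> T)) := cohomology_class @` Z3.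

End Cohomology.

(* Main.v *)
Require Import Defs.
From mathcomp Require Import all_boot all_order all_algebra.
From mathcomp Require Import boolp classical_sets functions.

(** Compare the coefficients of t in the identities satisfied by d, d' and phi,
    evaluated at constant series: those for d say that d_1 is a 3-cocycle (the
    fundamental identity becomes delta^3 d_1 = 0), and phi d = d' phi becomes
    d_1 - d'_1 = delta^1 phi_1. *)

Set Implicit Arguments.
Unset Strict Implicit.
Unset Printing Implicit Defensive.
Import GRing.Theory.
Local Open Scope classical_set_scope.
Local Open Scope ring_scope.

Section LowCoefficients.
Variables (F : fieldType) (T : lmodType F).

Definition tconst (x : T) : tseries T := fun n => if n is 0 then x else 0.

Lemma linear_fun0 (f : T -> T) : linear f -> f 0 = 0.
Proof.
by move=> lf; have := lf (-1) 0 0; rewrite scaler0 addr0 scaleN1r addNr.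
Qed.

(** Clears the terms in which a constant series supplies its coefficient of t, which is zero. *)
Lemma trilinear0 (f : T -> T -> T -> T) : trilinear f ->
  [/\ forall y z, f 0 y z = 0, forall x z, f x 0 z = 0
    & forall x y, f x y 0 = 0].
Proof.
case=> l1 l2 l3; split=> a b.
- exact: linear_fun0 (l1 a b).
- exact: linear_fun0 (l2 a b).
- exact: linear_fun0 (l3 a b).
Qed.

Lemma tmap1_coef0 (phi : nat -> T -> T) x : tmap1 phi x 0%N = phi 0%N (x 0%N).
Proof. by rewrite /tmap1 big_ord1. Qed.

Lemma tmap1_coef1 (phi : nat -> T -> T) x :
  tmap1 phi x 1%N = phi 0%N (x 1%N) + phi 1%N (x 0%N).
Proof. by rewrite /tmap1 !big_ord_recl big_ord0 addr0. Qed.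

Lemma text3_coef0 (f : T -> T -> T -> T) x y z :
  text3 f x y z 0%N = f (x 0%N) (y 0%N) (z 0%N).
Proof. by rewrite /text3 !big_ord1 big_mkcond big_ord1. Qed.

Lemma text3_coef1 (f : T -> T -> T -> T) x y z :
  text3 f x y z 1%N = f (x 0%N) (y 0%N) (z 1%N) + f (x 0%N) (y 1%N) (z 0%N)
    + f (x 1%N) (y 0%N) (z 0%N).
Proof.
rewrite /text3.
(* The condition [i + j + k == n] becomes a conditional summand, which computes once the sums are
   unrolled. *)
under eq_bigr do under eq_bigr do rewrite big_mkcond.
by rewrite !(big_ord_recl, big_ord0) /= ?addr0 ?add0r.
Qed.

Lemma tmap3_coef0 (d : nat -> T -> T -> T -> T) x y z :
  tmap3 d x y z 0%N = d 0%N (x 0%N) (y 0%N) (z 0%N).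
Proof. by rewrite /tmap3 big_ord1 text3_coef0. Qed.

(** The factor t comes either from one argument, under [d 0], or from the series [d] itself, under
    [d 1]. *)
Lemma tmap3_coef1 (d : nat -> T -> T -> T -> T) x y z :
  tmap3 d x y z 1%N =
    d 0%N (x 0%N) (y 0%N) (z 1%N) + d 0%N (x 0%N) (y 1%N) (z 0%N)
    + d 0%N (x 1%N) (y 0%N) (z 0%N) + d 1%N (x 0%N) (y 0%N) (z 0%N).
Proof.
by rewrite /tmap3 !big_ord_recl big_ord0 addr0 text3_coef1 text3_coef0.
Qed.

End LowCoefficients.

(** At constants, each of the four nested terms of the fundamental identity contributes to the
    coefficient of t a bracket with an entry from [d 1] and a value of [d 1] with a bracket as
    entry: the eight terms of [delta3]. *)
Lemma deform1_cocycle (F : fieldType) (T : lmodType F) (H : homLTS T)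
    (d : nat -> T -> T -> T -> T) :
  formal_deformation H d -> Z3 H (d 1%N).
Proof.
move=> hd; have [b1 b2 b3] := trilinear0 (bracket_trilinear H).
have a0 : twist H 0 = 0 by exact: raddf0.
pose simp := (tmap3_coef1, tmap3_coef0, deform0 hd, b1, b2, b3, a0,
  add0r, addr0).
split; first split.
- exact: deform_trilinear hd 1%N.
- move=> x y z.
  have := congr1 (@^~ 1%N)
    (deform_twist hd (tconst x) (tconst y) (tconst z)).
  by rewrite /= /text1 !simp /= ?simp.
- move=> x z.
  have := congr1 (@^~ 1%N) (deform_alt hd (tconst x) (tconst z)).
  by rewrite /= !simp /= ?simp.
- move=> x y z.
  have := congr1 (@^~ 1%N)
    (deform_cyclic hd (tconst x) (tconst y) (tconst z)).
  by rewrite /= !fctE !simp /= ?simp.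
- apply/funext => u; apply/funext => v; apply/funext => x.
  apply/funext => y; apply/funext => z.
  have := congr1 (@^~ 1%N) (deform_hom_fundamental hd (tconst u) (tconst v)
    (tconst x) (tconst y) (tconst z)).
  rewrite /= !fctE /text1 !simp /= ?simp /delta3 => E.
  (* Each pair joins the two contributions of one nested term; the first three pairs sum to the
     right side of [E], the last is minus its left side. *)
  rewrite (ACl ((1*5)*(2*6)*(3*7)*(4*8)))%AC /= -E -opprD.
  exact: subrr.
Qed.

Theorem theorem4p3 (F : fieldType) (T : lmodType F) (H : homLTS T)
    (d d' : nat -> T -> T -> T -> T)
    (hd : formal_deformation H d) (hd' : formal_deformation H d')
    (hdd' : deform_equiv H d d') :
  exists2 c : set (T -> T -> T -> T), H3 H c & c (d 1%N) /\ c (d' 1%N).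
Proof.
have [b1 b2 b3] := trilinear0 (bracket_trilinear H).
have a0 : twist H 0 = 0 by exact: raddf0.
have Zd := deform1_cocycle hd; have Zd' := deform1_cocycle hd'.
case: hdd' => phi [phi_lin phi0 _ phi_twist phi_deform].
exists (cohomology_class H (d' 1%N)); first by exists (d' 1%N).
split; split=> //.
(* That [phi 1] commutes with the twist is the coefficient of t in the commutation of [phi] with
   it. *)
- exists (phi 1%N).
    split=> [|x]; first exact: phi_lin.
    have := congr1 (@^~ 1%N) (phi_twist (tconst x)).
    by rewrite /= /text1 !tmap1_coef1 phi0 /= a0 !add0r.
  apply/funext => x; apply/funext => y; apply/funext => z.
  have := congr1 (@^~ 1%N)
    (phi_deform (tconst x) (tconst y) (tconst z)).
  rewrite /= tmap1_coef1 !tmap3_coef1 !tmap3_coef0 !tmap1_coef1 !tmap1_coef0.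
  rewrite phi0 (deform0 hd) (deform0 hd') /= b1 b2 b3 !add0r => E.
  rewrite /delta1 !fctE.
  (* As [phi 0] is the identity, the left side of [E] is [d 1 x y z] plus [phi 1] of the bracket;
     adding and subtracting the latter lets [E] apply. *)
  rewrite -[d 1%N x y z](addrK (phi 1%N (bracket H x y z))) E.
  rewrite [RHS]addrAC addrK; congr (_ - _).
  by rewrite [RHS](ACl (3*2*1))%AC.
(* The class is that of [d' 1] itself, so the difference is zero, the coboundary of the zero map. *)
- exists (fun=> 0).
    by split=> [a u v|x]; rewrite ?a0 // scaler0 addr0.
  apply/funext => x; apply/funext => y; apply/funext => z.
  by rewrite subrr /delta1 b1 b2 b3 subr0 !addr0.
Qed.
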